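(* Let $a_1\in D$ be a pure quaternion with $N(a_1)\in -u\mathbb{Q}_2^{*2}$, where $u$ is a unit of non-minimal quadratic defect (i.e. $u\in-\mathbb{Z}_2^{*2}\cup-5\mathbb{Z}_2^{*2}$), and let $t\in\{3,4\}$. Say that $r\in\mathcal{O}_D$ satisfies the $k$-star conditions if $\left(\frac{N(1-r),\,-N(a_1)}{2}\right)=-1$, $N(z)N(a_1)\in\mathbb{Q}_2^{*2}$ and $N(z)N(2^ta_1)^{-1}\in\mathbb{Z}_2$, where $z=a_1-ra_1\bar r$. Then there exists $r\in\mathcal{O}_D$ satisfying the $k$-star conditions if and only if there exists $\alpha=a+b\omega+ci+di\omega$ with $a,b,c,d\in\mathbb{Z}$, $0\le a,b,c,d<2^{t+3}$, satisfying them.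
   Context: $D=\left(\frac{2,5}{\mathbb{Q}_2}\right)$ is the quaternion division algebra over $\mathbb{Q}_2$ with basis $1,i,j,ij$, $i^2=2$, $j^2=5$, $ij=-ji$; $\omega=(1+j)/2$; $q\mapsto\bar q$ is the canonical involution and $N$ the reduced norm; $\mathcal{O}_D=\mathbb{Z}_2\oplus\mathbb{Z}_2\omega\oplus\mathbb{Z}_2i\oplus\mathbb{Z}_2i\omega$ is the maximal order. $\left(\frac{x,y}{2}\right)$ is the Hilbert symbol of $\mathbb{Q}_2$. *)

(* Defs.v *)
(* The field Q_2 of 2-adic numbers is not in the installed
   libraries, so we construct it honestly:
   - Z_2 = inverse limit of Z/2^n Z, represented by coherent integer sequences
     x with x (n+1) = x n mod 2^n; two sequences are equal as 2-adic integers
     iff x n = y n mod 2^n for all n  (relation [Z2eq]).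
   - Q_2 = Z_2[1/2], an element (k, x) representing x / 2^k; equality
     (k,x) ~ (l,y) iff 2^l x = 2^k y in Z_2 (relation [Q2eq]).
   All predicates below are stated up to these equivalences. *)
From mathcomp Require Import all_boot all_algebra.
From mathcomp Require Import ring.
Set Implicit Arguments. Unset Strict Implicit. Unset Printing Implicit Defensive.
Import GRing.Theory Num.Theory.
Local Open Scope ring_scope.

Record Z2 := MkZ2 {
  z2s : nat -> int;
  z2coh : forall n : nat, ((2 ^+ n : int) %| z2s n.+1 - z2s n)%Z }.

Definition Z2eq (x y : Z2) : Prop :=
  forall n : nat, ((2 ^+ n : int) %| z2s x n - z2s y n)%Z.

Lemma Z2const_coh (c : int) (n : nat) : ((2 ^+ n : int) %| c - c)%Z.
Proof. by rewrite subrr dvdz0. Qed.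
Definition Z2const (c : int) : Z2 := @MkZ2 (fun _ => c) (Z2const_coh c).

Lemma Z2add_coh (x y : Z2) (n : nat) :
  ((2 ^+ n : int) %| (z2s x n.+1 + z2s y n.+1) - (z2s x n + z2s y n))%Z.
Proof.
have -> : (z2s x n.+1 + z2s y n.+1) - (z2s x n + z2s y n)
        = (z2s x n.+1 - z2s x n) + (z2s y n.+1 - z2s y n) by ring.
by rewrite rpredD // z2coh.
Qed.
Definition Z2add (x y : Z2) : Z2 :=
  @MkZ2 (fun n => z2s x n + z2s y n) (Z2add_coh x y).

Lemma Z2opp_coh (x : Z2) (n : nat) :
  ((2 ^+ n : int) %| (- z2s x n.+1) - (- z2s x n))%Z.
Proof.
have -> : (- z2s x n.+1) - (- z2s x n) = - (z2s x n.+1 - z2s x n) by ring.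
by rewrite rpredN z2coh.
Qed.
Definition Z2opp (x : Z2) : Z2 := @MkZ2 (fun n => - z2s x n) (Z2opp_coh x).

Lemma Z2mul_coh (x y : Z2) (n : nat) :
  ((2 ^+ n : int) %| (z2s x n.+1 * z2s y n.+1) - (z2s x n * z2s y n))%Z.
Proof.
have -> : (z2s x n.+1 * z2s y n.+1) - (z2s x n * z2s y n)
        = z2s x n.+1 * (z2s y n.+1 - z2s y n) + (z2s x n.+1 - z2s x n) * z2s y n
  by ring.
by apply: rpredD; [apply: dvdz_mull | apply: dvdz_mulr]; exact: z2coh.
Qed.
Definition Z2mul (x y : Z2) : Z2 :=
  @MkZ2 (fun n => z2s x n * z2s y n) (Z2mul_coh x y).

Definition Z2unit (x : Z2) : Prop := exists v : Z2, Z2eq (Z2mul x v) (Z2const 1).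

Definition Q2 := (nat * Z2)%type.   (* (k, x) stands for x / 2^k *)

Definition Q2of (x : Z2) : Q2 := (0%N, x).
Definition Q2const (c : int) : Q2 := Q2of (Z2const c).

Definition Q2eq (p q : Q2) : Prop :=
  Z2eq (Z2mul (Z2const (2 ^+ q.1)) p.2) (Z2mul (Z2const (2 ^+ p.1)) q.2).

Definition Q2add (p q : Q2) : Q2 :=
  ((p.1 + q.1)%N, Z2add (Z2mul (Z2const (2 ^+ q.1)) p.2)
                        (Z2mul (Z2const (2 ^+ p.1)) q.2)).
Definition Q2opp (p : Q2) : Q2 := (p.1, Z2opp p.2).
Definition Q2sub (p q : Q2) : Q2 := Q2add p (Q2opp q).
Definition Q2mul (p q : Q2) : Q2 := ((p.1 + q.1)%N, Z2mul p.2 q.2).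

Definition Q2nz (p : Q2) : Prop := ~ Q2eq p (Q2const 0).

Definition Q2nzsq (p : Q2) : Prop :=
  Q2nz p /\ exists s : Q2, Q2eq p (Q2mul s s).

Definition hilbert_m1 (x y : Q2) : Prop :=
  ~ exists X Y Z : Q2, (Q2nz X \/ Q2nz Y \/ Q2nz Z) /\
      Q2eq (Q2mul Z Z) (Q2add (Q2mul x (Q2mul X X)) (Q2mul y (Q2mul Y Y))).

(* coordinates in the basis 1, i, j, ij *)
Definition quat := (Q2 * Q2 * Q2 * Q2)%type.
Definition q0 (x : quat) : Q2 := x.1.1.1.
Definition q1 (x : quat) : Q2 := x.1.1.2.
Definition q2 (x : quat) : Q2 := x.1.2.
Definition q3 (x : quat) : Q2 := x.2.
Definition mkq (a b c d : Q2) : quat := (a, b, c, d).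

Definition Qa : Q2 := Q2const 2.   (* i^2 *)
Definition Qb : Q2 := Q2const 5.   (* j^2 *)

Definition quat_mul (x y : quat) : quat :=
  let s := Q2add in let m := Q2mul in let d := Q2sub in
  mkq (d (s (s (m (q0 x) (q0 y)) (m Qa (m (q1 x) (q1 y))))
                (m Qb (m (q2 x) (q2 y))))
         (m (m Qa Qb) (m (q3 x) (q3 y))))
      (s (d (s (m (q0 x) (q1 y)) (m (q1 x) (q0 y)))
            (m Qb (m (q2 x) (q3 y))))
         (m Qb (m (q3 x) (q2 y))))
      (d (s (s (m (q0 x) (q2 y)) (m (q2 x) (q0 y)))
            (m Qa (m (q1 x) (q3 y))))
         (m Qa (m (q3 x) (q1 y))))
      (d (s (s (m (q0 x) (q3 y)) (m (q3 x) (q0 y))) (m (q1 x) (q2 y)))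
         (m (q2 x) (q1 y))).

Definition quat_sub (x y : quat) : quat :=
  mkq (Q2sub (q0 x) (q0 y)) (Q2sub (q1 x) (q1 y))
      (Q2sub (q2 x) (q2 y)) (Q2sub (q3 x) (q3 y)).

Definition quat_scale (c : Q2) (x : quat) : quat :=
  mkq (Q2mul c (q0 x)) (Q2mul c (q1 x)) (Q2mul c (q2 x)) (Q2mul c (q3 x)).

Definition quat_conj (x : quat) : quat :=
  mkq (q0 x) (Q2opp (q1 x)) (Q2opp (q2 x)) (Q2opp (q3 x)).

Definition quat_one : quat :=
  mkq (Q2const 1) (Q2const 0) (Q2const 0) (Q2const 0).

Definition qnorm (x : quat) : Q2 :=
  Q2add (Q2sub (Q2sub (Q2mul (q0 x) (q0 x)) (Q2mul Qa (Q2mul (q1 x) (q1 x))))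
               (Q2mul Qb (Q2mul (q2 x) (q2 x))))
        (Q2mul (Q2mul Qa Qb) (Q2mul (q3 x) (q3 x))).

Definition pure (x : quat) : Prop := Q2eq (q0 x) (Q2const 0).

(* the element  al + be*omega + ga*i + de*i*omega  of O_D, omega = (1+j)/2,
   i.e. (al + be/2) + (ga + de/2) i + (be/2) j + (de/2) ij *)
Definition half (x : Z2) : Q2 := (1%N, x).
Definition OD_elt (al be ga de : Z2) : quat :=
  mkq (half (Z2add (Z2mul (Z2const 2) al) be))
      (half (Z2add (Z2mul (Z2const 2) ga) de))
      (half be) (half de).

Definition div_in_Z2 (p q : Q2) : Prop :=
  Q2nz q /\ exists w : Z2, Q2eq p (Q2mul (Q2of w) q).

Definition nonminimal_defect_unit (u : Z2) : Prop :=
  exists s : Z2, Z2unit s /\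
    (Z2eq u (Z2opp (Z2mul s s)) \/
     Z2eq u (Z2opp (Z2mul (Z2const 5) (Z2mul s s)))).

Definition kstar (a1 : quat) (t : nat) (r : quat) : Prop :=
  let z := quat_sub a1 (quat_mul (quat_mul r a1) (quat_conj r)) in
  [/\ hilbert_m1 (qnorm (quat_sub quat_one r)) (Q2opp (qnorm a1)),
      Q2nzsq (Q2mul (qnorm z) (qnorm a1)) &
      div_in_Z2 (qnorm z) (qnorm (quat_scale (Q2const (2 ^+ t)) a1))].

(* Main.v *)
Require Import Defs.
From HB Require Import structures.
From mathcomp Require Import all_boot all_algebra generic_quotient fraction.
From mathcomp Require Import boolp ring zify.
Set Implicit Arguments. Unset Strict Implicit. Unset Printing Implicit Defensive.
Import GRing.Theory Num.Theory.
Local Open Scope ring_scope.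
Local Open Scope quotient_scope.

(* Both sides of the equivalence are false: under these hypotheses no [r] satisfies the
   k-star conditions.  Write [m = N(a1) = eps mu^2] with [eps] in [{1, 5}] and
   [W^2 = N(z)/m]; the conditions force [W] into [8 Z_2].  The quaternions
   [X = m r - a1 r a1] and [E = m r + a1 r a1] are [2m] times the parts of [r] commuting
   and anticommuting with [a1], and [N(E) = m^2 (W^2 - (N(r) - 1)^2)].
   - If [N(r)] is not [1] mod [8], then [-N(E)] lies in the square class of a unit
     [1 + 4 k]; since [E] is pure and orthogonal to [a1] this produces an isotropic
     vector of the norm form of [D], which is anisotropic.
   - If [N(r) = 1] mod [8], then [alpha = (1 + N(r) + W)/2] is [1] mod [4], hence of the
     form [p^2 + eps q^2], and [h = (2 m alpha - X)(mu p - q a1)] commutes with [a1] and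
     has norm [N(1 - r) (2 m mu alpha)^2].  An element of the centralizer [Q_2(a1)] has
     norm [h0^2 + m Y^2], so [N(1 - r)] is represented by [<1, N(a1)>], i.e. the Hilbert
     symbol [(N(1 - r), -N(a1))_2] is [1]. *)

(** * The ring of 2-adic integers *)

Local Notation dvd2 n x := ((2 ^+ n : int) %| x)%Z.

Lemma dvd2W (m n : nat) (x : int) : (m <= n)%N -> dvd2 n x -> dvd2 m x.
Proof. by move=> mn; apply: dvdz_trans; apply: dvdz_exp2l. Qed.

Lemma dvd2_subtrans (n : nat) (x y z : int) :
  dvd2 n (x - y) -> dvd2 n (y - z) -> dvd2 n (x - z).
Proof. by move=> h1 h2; rewrite -[x](subrK y) -addrA rpredD. Qed.

Lemma dvd2_subeq (n : nat) (x y : int) : x = y -> dvd2 n (x - y).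
Proof. by move=> ->; rewrite subrr dvdz0. Qed.

Lemma dvd2_mulpow2 (n k : nat) (a : int) : dvd2 (n + k) (2 ^+ k * a) -> dvd2 n a.
Proof. by rewrite exprD [2 ^+ n * _]mulrC dvdz_mul2l // expf_neq0. Qed.

Lemma z2s_cohW (x : Z2) (n m : nat) : (n <= m)%N -> dvd2 n (z2s x m - z2s x n).
Proof.
elim: m => [|m IH]; first by rewrite leqn0 => /eqP ->; apply: dvd2_subeq.
rewrite leq_eqVlt => /orP [/eqP ->|]; first exact: dvd2_subeq.
by rewrite ltnS => nm; apply: dvd2_subtrans (dvd2W nm (z2coh x m)) (IH nm).
Qed.

Lemma Z2eq_refl x : Z2eq x x.
Proof. by move=> n; apply: dvd2_subeq. Qed.
Lemma Z2eq_sym x y : Z2eq x y -> Z2eq y x.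
Proof. by move=> h n; rewrite -opprB rpredN. Qed.
Lemma Z2eq_trans x y z : Z2eq x y -> Z2eq y z -> Z2eq x z.
Proof. by move=> h1 h2 n; apply: dvd2_subtrans (h1 n) (h2 n). Qed.

Lemma Z2add_compat x x' y y' : Z2eq x x' -> Z2eq y y' -> Z2eq (Z2add x y) (Z2add x' y').
Proof. by move=> h1 h2 n /=; rewrite opprD addrACA; apply: rpredD. Qed.
Lemma Z2opp_compat x x' : Z2eq x x' -> Z2eq (Z2opp x) (Z2opp x').
Proof. by move=> h n /=; rewrite -opprD rpredN. Qed.
Lemma Z2mul_compat x x' y y' : Z2eq x x' -> Z2eq y y' -> Z2eq (Z2mul x y) (Z2mul x' y').
Proof.
move=> h1 h2 n /=; have -> : z2s x n * z2s y n - z2s x' n * z2s y' n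
  = z2s x n * (z2s y n - z2s y' n) + (z2s x n - z2s x' n) * z2s y' n by ring.
by apply: rpredD; [apply: dvdz_mull | apply: dvdz_mulr].
Qed.

HB.instance Definition _ := gen_eqMixin Z2.
HB.instance Definition _ := gen_choiceMixin Z2.

Definition Z2eqb (x y : Z2) : bool := `[< Z2eq x y >].
Lemma Z2eqb_refl : reflexive Z2eqb. Proof. by move=> x; apply/asboolP/Z2eq_refl. Qed.
Lemma Z2eqb_sym : symmetric Z2eqb.
Proof. by move=> x y; apply/asboolP/asboolP; apply: Z2eq_sym. Qed.
Lemma Z2eqb_trans : transitive Z2eqb.
Proof. by move=> y x z /asboolP h1 /asboolP h2; apply/asboolP/(Z2eq_trans h1 h2). Qed.
Canonical Z2eqb_equiv := EquivRel Z2eqb Z2eqb_refl Z2eqb_sym Z2eqb_trans.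

Definition Z2r := {eq_quot Z2eqb}.
HB.instance Definition _ := Choice.on Z2r.
Definition piZ (x : Z2) : Z2r := \pi_Z2r x.

Lemma piZP x y : piZ x = piZ y <-> Z2eq x y.
Proof. by split=> [/eqquotP/asboolP | h]; last apply/eqquotP/asboolP. Qed.

Lemma repr_piZ x : Z2eq (repr (piZ x)) x.
Proof. by apply/piZP; rewrite /piZ reprK. Qed.

Lemma piZ_surj (x : Z2r) : exists x' : Z2, x = piZ x'.
Proof. by exists (repr x); rewrite /piZ reprK. Qed.

Definition Z2r_add := locked (fun x y : Z2r => piZ (Z2add (repr x) (repr y))).
Definition Z2r_opp := locked (fun x : Z2r => piZ (Z2opp (repr x))).
Definition Z2r_mul := locked (fun x y : Z2r => piZ (Z2mul (repr x) (repr y))).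

Lemma piZ_add x y : piZ (Z2add x y) = Z2r_add (piZ x) (piZ y).
Proof. by rewrite /Z2r_add -lock; apply/piZP/Z2add_compat; apply: Z2eq_sym; exact: repr_piZ. Qed.
Lemma piZ_opp x : piZ (Z2opp x) = Z2r_opp (piZ x).
Proof. by rewrite /Z2r_opp -lock; apply/piZP/Z2opp_compat; apply: Z2eq_sym; exact: repr_piZ. Qed.
Lemma piZ_mul x y : piZ (Z2mul x y) = Z2r_mul (piZ x) (piZ y).
Proof. by rewrite /Z2r_mul -lock; apply/piZP/Z2mul_compat; apply: Z2eq_sym; exact: repr_piZ. Qed.

Ltac Z2r_law := apply/piZP => ? /=; apply: dvd2_subeq; ring.

Lemma Z2r_addA : associative Z2r_add.
Proof. by do 3!elim/quotW=> ?; rewrite -!piZ_add; Z2r_law. Qed.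
Lemma Z2r_addC : commutative Z2r_add.
Proof. by do 2!elim/quotW=> ?; rewrite -!piZ_add; Z2r_law. Qed.
Lemma Z2r_add0 : left_id (piZ (Z2const 0)) Z2r_add.
Proof. by elim/quotW=> ?; rewrite -!piZ_add; Z2r_law. Qed.
Lemma Z2r_addN : left_inverse (piZ (Z2const 0)) Z2r_opp Z2r_add.
Proof. by elim/quotW=> ?; rewrite -piZ_opp -!piZ_add; Z2r_law. Qed.
HB.instance Definition _ :=
  GRing.isZmodule.Build Z2r Z2r_addA Z2r_addC Z2r_add0 Z2r_addN.

Lemma Z2r_mulA : associative Z2r_mul.
Proof. by do 3!elim/quotW=> ?; rewrite -!piZ_mul; Z2r_law. Qed.
Lemma Z2r_mulC : commutative Z2r_mul.
Proof. by do 2!elim/quotW=> ?; rewrite -!piZ_mul; Z2r_law. Qed.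
Lemma Z2r_mul1 : left_id (piZ (Z2const 1)) Z2r_mul.
Proof. by elim/quotW=> ?; rewrite -!piZ_mul; Z2r_law. Qed.
Lemma Z2r_mulD : left_distributive Z2r_mul Z2r_add.
Proof. by do 3!elim/quotW=> ?; rewrite -!piZ_add -!piZ_mul -piZ_add; Z2r_law. Qed.
Lemma Z2r_oner_neq0 : piZ (Z2const 1) != piZ (Z2const 0).
Proof. by apply/eqP => /piZP /(_ 1%N); rewrite /= subr0 expr1. Qed.
HB.instance Definition _ := GRing.Zmodule_isComNzRing.Build Z2r
  Z2r_mulA Z2r_mulC Z2r_mul1 Z2r_mulD Z2r_oner_neq0.


Lemma piZD x y : piZ (Z2add x y) = piZ x + piZ y. Proof. exact: piZ_add. Qed.
Lemma piZN x : piZ (Z2opp x) = - piZ x. Proof. exact: piZ_opp. Qed.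
Lemma piZM x y : piZ (Z2mul x y) = piZ x * piZ y. Proof. exact: piZ_mul. Qed.

Lemma piZ0 : piZ (Z2const 0) = 0. Proof. by []. Qed.
Lemma piZ1 : piZ (Z2const 1) = 1. Proof. by []. Qed.

Lemma piZ_const (c : int) : piZ (Z2const c) = c%:~R.
Proof.
have piZ_nat (n : nat) : piZ (Z2const n) = n%:R.
  elim: n => [//|n IH]; rewrite -addn1 natrD -IH -[_ + 1]piZD.
  by apply/piZP => k; apply: dvd2_subeq; rewrite /= PoszD.
case: c => n; first exact: piZ_nat.
rewrite NegzE intrN; change (piZ (Z2const (- n.+1%:Z)) = - n.+1%:R).
by rewrite -piZ_nat -piZN; apply/piZP => k; apply: dvd2_subeq.
Qed.

Lemma pow2_piZ (k : nat) : (2 ^+ k : Z2r) = piZ (Z2const (2 ^+ k)).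
Proof. by rewrite piZ_const rmorphXn. Qed.

Lemma Z2_of_approx (P : nat -> int -> Prop) :
  (forall n, exists c, P n c) ->
  (forall n c c', P n.+1 c -> P n c' -> dvd2 n (c - c')) ->
  exists x : Z2, forall n, P n (z2s x n).
Proof.
move=> ex coh; pose s n := projT1 (cid (ex n)).
have sP n : P n (s n) by rewrite /s; case: (cid (ex n)).
by exists (MkZ2 (fun n => coh n _ _ (sP n.+1) (sP n))).
Qed.

Lemma Z2r_pow2_mul_eq0 (k : nat) (x : Z2r) : 2 ^+ k * x = 0 -> x = 0.
Proof.
have [x' ->] := piZ_surj x; rewrite pow2_piZ -piZM -piZ0 => /piZP h.
apply/piZP => n; rewrite /= subr0.
have := h (n + k)%N; rewrite /= subr0 => /dvd2_mulpow2 hx.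
have -> : z2s x' n = z2s x' (n + k)%N - (z2s x' (n + k)%N - z2s x' n) by ring.
by apply: rpredB => //; apply: z2s_cohW; apply: leq_addr.
Qed.

Lemma Z2r_pow2_dvd_eq0 (x : Z2r) : (forall k, exists y, x = 2 ^+ k * y) -> x = 0.
Proof.
have [x' ->] := piZ_surj x; move=> h; rewrite -piZ0; apply/piZP => n.
have [y ey] := h n; have [y' ey'] := piZ_surj y.
move: ey; rewrite ey' pow2_piZ -piZM => /piZP /(_ n) /= hn.
rewrite subr0 -[z2s x' n](subrK (2 ^+ n * z2s y' n)).
by apply: rpredD => //; apply: dvdz_mulr.
Qed.

Lemma Z2r_divmod_pow2 (x : Z2r) (k : nat) :
  exists (j : int) (y : Z2r), 0 <= j < 2 ^+ k /\ x = j%:~R + 2 ^+ k * y.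
Proof.
have [x' ->] := piZ_surj x; pose j := (z2s x' k %% 2 ^+ k)%Z.
have p2 : (2 ^+ k : int) != 0 by rewrite expf_neq0.
have xj m : (k <= m)%N -> dvd2 k (z2s x' m - j).
  move=> km; apply: dvd2_subtrans (z2s_cohW x' km) _.
  by rewrite {1}(divz_eq (z2s x' k) (2 ^+ k)) addrK dvdz_mull.
pose P n c := dvd2 (n + k) (z2s x' (n + k)%N - j - 2 ^+ k * c).
have [y' Hy] : exists y' : Z2, forall n, P n (z2s y' n).
  apply: (@Z2_of_approx P) => [n | n c c']; rewrite /P.
    have /dvdzP [c Hc] := xj (n + k)%N (leq_addl n k).
    by exists c; rewrite Hc mulrC subrr dvdz0.
  move=> H1 H2; apply: (@dvd2_mulpow2 n k).
  have -> : 2 ^+ k * (c - c') = (z2s x' (n.+1 + k)%N - z2s x' (n + k)%N)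
    + (z2s x' (n + k)%N - j - 2 ^+ k * c') - (z2s x' (n.+1 + k)%N - j - 2 ^+ k * c) by ring.
  apply: rpredB; last by apply: (dvd2W _ H1); rewrite addSn.
  by apply: rpredD => //; apply: z2s_cohW; rewrite addSn.
exists j, (piZ y'); split; first by rewrite modz_ge0 // ltz_pmod // exprn_gt0.
rewrite pow2_piZ -piZ_const -piZM -piZD; apply/piZP => n /=.
have -> : z2s x' n - (j + 2 ^+ k * z2s y' n) = (z2s x' (n + k)%N - j - 2 ^+ k * z2s y' n)
  - (z2s x' (n + k)%N - z2s x' n) by ring.
by apply: rpredB; [apply: (dvd2W _ (Hy n)) | apply: z2s_cohW]; apply: leq_addr.
Qed.

Lemma Z2r_int_pow2_dvd (c : int) (k : nat) (y : Z2r) :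
  (c%:~R : Z2r) = 2 ^+ k * y -> dvd2 k c.
Proof.
have [y' ->] := piZ_surj y; rewrite pow2_piZ -piZ_const -piZM => /piZP /(_ k) /= H.
by rewrite -[c](subrK (2 ^+ k * z2s y' k)); apply: rpredD => //; apply: dvdz_mulr.
Qed.

Lemma Z2r_odd_neq_even (w y : Z2r) : 1 + 2 * w <> 2 * y.
Proof.
move=> h; have /Z2r_int_pow2_dvd : ((1 : int)%:~R : Z2r) = 2 ^+ 1 * (y - w).
  by rewrite expr1 mulrBr -h addrK.
by [].
Qed.

Lemma Z2r_repr_congr (x y : Z2r) (c : int) (k : nat) : x = c%:~R + 2 ^+ k * y ->
  exists x' y' : Z2, x = piZ x' /\ forall n, dvd2 n (z2s x' n - (c + 2 ^+ k * z2s y' n)).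
Proof.
have [x' ->] := piZ_surj x; have [y' ->] := piZ_surj y.
by rewrite pow2_piZ -piZ_const -piZM -piZD => /piZP H; exists x', y'.
Qed.

Lemma dvd2_drop (n k : nat) (x c y : int) :
  (n <= k)%N -> dvd2 n (x - (c + 2 ^+ k * y)) -> dvd2 n (x - c).
Proof.
move=> nk h; have -> : x - c = (x - (c + 2 ^+ k * y)) + 2 ^+ k * y by ring.
by apply: rpredD => //; apply/dvdz_mulr/dvdz_exp2l.
Qed.

Lemma int_inv_mod_pow2 (a : int) (n : nat) : dvd2 1 (a - 1) -> exists v, dvd2 n (a * v - 1).
Proof.
move=> ha; elim: n => [|n [v Hv]]; first by exists 0; rewrite expr0 dvd1z.
case: n Hv => [|n] Hv; first by exists 1; rewrite mulr1.
exists (v * (2 - a * v)).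
have -> : a * (v * (2 - a * v)) - 1 = - ((a * v - 1) * (a * v - 1)) by ring.
by rewrite rpredN; apply: (@dvd2W _ (n.+1 + n.+1)); rewrite ?exprD ?dvdz_mul //; lia.
Qed.

Lemma dvd2_odd_cancel (m : nat) (u o : int) :
  dvd2 1 (o - 1) -> dvd2 m (u * o) -> dvd2 m u.
Proof.
move=> ho h; have [v Hv] := int_inv_mod_pow2 m ho.
have -> : u = (u * o) * v - u * (o * v - 1) by ring.
by apply: rpredB; [apply: dvdz_mulr | apply: dvdz_mull].
Qed.

Lemma int_sqrt_mod_pow2 (c : int) (k : nat) : dvd2 3 (c - 1) ->
  exists s, dvd2 2 (s - 1) /\ dvd2 k.+3 (s * s - c).
Proof.
move=> hc; elim: k => [|k [s [/dvdzP [g hg] /dvdzP [e He]]]].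
  by exists 1; rewrite subrr dvdz0 mulr1 -opprB rpredN.
have es : s = g * 2 ^+ 2 + 1 by rewrite -hg; ring.
have ec : c = s * s - e * 2 ^+ k.+3 by rewrite -He; ring.
have /orP [/dvdzP [f ef] | /dvdzP [f ef]] : (2 %| e)%Z || (2 %| e - 1)%Z by lia.
  exists s; rewrite hg dvdz_mull; split => //.
  by rewrite He ef -mulrA -exprS dvdz_mull.
have {}ef : e = f * 2 + 1 by rewrite -ef; ring.
(* when the error term is odd, adding 2^(k+2) to s corrects it *)
exists (s + 2 ^+ k.+2); split.
  have -> : s + 2 ^+ k.+2 - 1 = (g + 2 ^+ k) * 2 ^+ 2 by rewrite es !exprS; ring.
  exact: dvdz_mull.
have -> : (s + 2 ^+ k.+2) * (s + 2 ^+ k.+2) - c = (f + 2 * g + 1 + 2 ^+ k) * 2 ^+ k.+4.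
  by rewrite ec ef es !exprS; ring.
exact: dvdz_mull.
Qed.

Lemma int_sqr_congr (n : nat) (s s' : int) : dvd2 2 (s - 1) -> dvd2 2 (s' - 1) ->
  dvd2 n.+1 (s * s - s' * s') -> dvd2 n (s - s').
Proof.
move=> hs hs' h.
have /dvdzP [q hq] : dvd2 2 ((s - 1) + (s' - 1)) by apply: rpredD.
apply: (@dvd2_odd_cancel _ _ (1 + 2 * q)); first by apply/dvdzP; exists q; rewrite expr1; ring.
apply: (@dvd2_mulpow2 n 1); rewrite addn1.
suff -> : 2 ^+ 1 * ((s - s') * (1 + 2 * q)) = s * s - s' * s' by [].
have -> : s' = q * 2 ^+ 2 - s + 2 by rewrite -hq; ring.
ring.
Qed.

Lemma Z2r_odd_unit (y : Z2r) : exists v, (1 + 2 * y) * v = 1.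
Proof.
have e : 1 + 2 * y = (1 : int)%:~R + 2 ^+ 1 * y by rewrite expr1.
have [x' [y' [-> H]]] := Z2r_repr_congr e.
pose P n c := dvd2 n (z2s x' n * c - 1).
have [v Hv] : exists v : Z2, forall n, P n (z2s v n).
  apply: (@Z2_of_approx P) => [[|n] | n c c']; rewrite /P.
  - by exists 0; rewrite expr0 dvd1z.
  - by apply/int_inv_mod_pow2/(dvd2_drop (leqnn 1))/(dvd2W _ (H n.+1)).
  move=> H1 H2; have -> : c - c' = - c * (z2s x' n * c' - 1) + c' * (z2s x' n.+1 * c - 1)
     - c * c' * (z2s x' n.+1 - z2s x' n) by ring.
  apply: rpredB; last exact/dvdz_mull/z2coh.
  by apply: rpredD; apply: dvdz_mull => //; apply: (dvd2W (leqnSn n)).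
by exists (piZ v); rewrite -piZM -piZ1; apply/piZP => n /=; exact: Hv.
Qed.

Lemma Z2r_square_1mod8 (y : Z2r) : exists r, 1 + 8 * y = r * r.
Proof.
have e : 1 + 8 * y = (1 : int)%:~R + 2 ^+ 3 * y by rewrite -natrX.
have [x' [y' [-> H]]] := Z2r_repr_congr e.
have x'1 n : dvd2 3 (z2s x' (n + 3)%N - 1).
  exact/(dvd2_drop (leqnn 3))/(dvd2W (leq_addl n 3) (H (n + 3)%N)).
pose P n s := dvd2 2 (s - 1) /\ dvd2 (n + 3) (s * s - z2s x' (n + 3)%N).
have [v Hv] : exists v : Z2, forall n, P n (z2s v n).
  apply: (@Z2_of_approx P) => [n | n s s' [hs1 hs2] [hs1' hs2']].
    by have [s hs] := int_sqrt_mod_pow2 n (x'1 n); exists s; move: hs; rewrite /P addn3.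
  apply: (dvd2W (leq_addr 2 n)); apply: int_sqr_congr => //; rewrite addn2 -(addn3 n).
  apply: dvd2_subtrans (_ : dvd2 (n + 3) (s * s - z2s x' (n + 3)%N)) _.
    by apply: dvd2_subtrans (dvd2W _ hs2) _; rewrite ?z2s_cohW // addSn.
  by rewrite -opprB rpredN.
exists (piZ v); rewrite -piZM; apply/piZP => n /=.
apply: dvd2_subtrans (_ : dvd2 n (z2s x' n - z2s x' (n + 3)%N)) _.
  by rewrite -opprB rpredN z2s_cohW // leq_addr.
by rewrite -opprB rpredN; case: (Hv n) => _ /(dvd2W (leq_addr 3 n)).
Qed.

Lemma Z2r_valuation (x : Z2r) : x != 0 -> exists (j : nat) (w : Z2r), x = 2 ^+ j * (1 + 2 * w).
Proof.
move=> x0; pose dvd k := `[< exists y, x = 2 ^+ k * y >].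
have [k ndvd] : exists k, ~~ dvd k.
  apply: contrapT => hn; move/eqP: x0; apply; apply: Z2r_pow2_dvd_eq0 => k.
  by apply: contrapT => hk; apply: hn; exists k; apply/asboolPn.
have ex_ndvd : exists k, (fun k => ~~ dvd k) k by exists k.
case: (ex_minnP ex_ndvd) => {k ndvd ex_ndvd} [[|j]] /asboolPn ndvd min_j.
  by case: ndvd; exists x; rewrite mul1r.
have /asboolP [u xu] : dvd j by apply: contraT => /min_j; rewrite ltnn.
have [c [w [/andP [c0 c1] uw]]] := Z2r_divmod_pow2 u 1.
have /orP [/eqP c_0 | /eqP c_1] : (c == 0) || (c == 1) by lia.
  by case: ndvd; exists w; rewrite xu uw c_0 mulr0z add0r expr1 exprSr mulrA.
by exists j, w; rewrite xu uw c_1 expr1.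
Qed.

Definition Z2r_unit : {pred Z2r} := fun x => `[< exists y, y * x = 1 >].
Definition Z2r_inv (x : Z2r) : Z2r :=
  if pselect (exists y, y * x = 1) is left h then projT1 (cid h) else x.

Lemma Z2r_mulVr : {in Z2r_unit, left_inverse 1 Z2r_inv *%R}.
Proof.
move=> x /asboolP ux; rewrite /Z2r_inv; case: pselect => // h.
exact: (projT2 (cid h)).
Qed.
Lemma Z2r_unitPl (x y : Z2r) : y * x = 1 -> Z2r_unit x.
Proof. by move=> h; apply/asboolP; exists y. Qed.
Lemma Z2r_inv_out : {in [predC Z2r_unit], Z2r_inv =1 id}.
Proof.
move=> x /negP nux; rewrite /Z2r_inv; case: pselect => // h.
by case: nux; apply/asboolP.
Qed.
HB.instance Definition _ :=
  GRing.ComNzRing_hasMulInverse.Build Z2r Z2r_mulVr Z2r_unitPl Z2r_inv_out.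

Lemma Z2r_idomain : GRing.integral_domain_axiom Z2r.
Proof.
move=> x y xy0; apply/norP => [[/Z2r_valuation [j [w ex]] /Z2r_valuation [i [v ey]]]].
apply: (@Z2r_odd_neq_even (w + v + 2 * w * v) 0); rewrite mulr0.
by apply: (@Z2r_pow2_mul_eq0 (j + i)); rewrite -xy0 ex ey exprD; ring.
Qed.
HB.instance Definition _ := GRing.ComUnitRing_isIntegral.Build Z2r Z2r_idomain.

(** * The field of 2-adic numbers *)

Lemma frac_numden (R : idomainType) (x : {fraction R}) :
  exists a b : R, b != 0 /\ x = FracField.tofrac a / FracField.tofrac b.
Proof.
elim/quotW: x => r; exists (\n_r), (\d_r); split; first exact: denom_ratioP.
apply: (canRL (mulfK _)); first by rewrite tofrac_eq0 denom_ratioP.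
unlock FracField.tofrac; rewrite -[_ * _]FracField.pi_mul; apply/eqmodP.
rewrite /= FracField.equivfE /FracField.mulf /= !numden_Ratio ?mulf_neq0 ?denom_ratioP //.
all: by rewrite ?oner_neq0 // !mulr1 mulrC.
Qed.

Local Notation Q2f := {fraction Z2r}.
Local Notation "x %:F" := (@FracField.tofrac Z2r x).

Lemma Z2r_2_neq0 : (2 : Z2r) != 0.
Proof.
apply/eqP => h; have /Z2r_int_pow2_dvd : ((2 : int)%:~R : Z2r) = 2 ^+ 2 * 0.
  by rewrite mulr0.
by [].
Qed.

Lemma Q2f_2_neq0 : (2 : Q2f) != 0.
Proof. by rewrite -(rmorph_nat (@FracField.tofrac Z2r)) tofrac_eq0 Z2r_2_neq0. Qed.

Lemma Q2f_pow2_neq0 (k : nat) : (2 : Q2f) ^+ k != 0.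
Proof. exact/expf_neq0/Q2f_2_neq0. Qed.

Lemma tofrac_pow2 (k : nat) : (2 ^+ k)%:F = 2 ^+ k :> Q2f.
Proof. by rewrite rmorphXn rmorph_nat. Qed.

Lemma Q2f_dyadic (x : Q2f) : exists (k : nat) (y : Z2r), x = y%:F / 2 ^+ k.
Proof.
have [a [b [b0 ->]]] := frac_numden x.
have [j [w bw]] := Z2r_valuation b0; have [v wv] := Z2r_odd_unit w.
exists j, (a * v); apply/eqP; rewrite eqr_div ?tofrac_eq0 ?Q2f_pow2_neq0 //.
by rewrite -tofrac_pow2 -!rmorphM bw mulrACA [v * _]mulrC wv mulr1.
Qed.

Definition Z2int : {pred Q2f} := fun x => `[< exists y, x = y%:F >].

Lemma Z2intP (x : Q2f) : reflect (exists y, x = y%:F) (x \in Z2int).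
Proof. exact: asboolP. Qed.

Lemma tofrac_Z2int (y : Z2r) : y%:F \in Z2int.
Proof. by apply/Z2intP; exists y. Qed.

Lemma Z2int_subring : subring_closed Z2int.
Proof.
split=> [|_ _ /Z2intP [a ->] /Z2intP [b ->]|_ _ /Z2intP [a ->] /Z2intP [b ->]].
- by rewrite -(rmorph1 (@FracField.tofrac Z2r)) tofrac_Z2int.
- by rewrite -rmorphB tofrac_Z2int.
- by rewrite -rmorphM tofrac_Z2int.
Qed.
HB.instance Definition _ := GRing.isSubringClosed.Build Q2f Z2int Z2int_subring.

Definition embQ (p : Q2) : Q2f := (piZ p.2)%:F / 2 ^+ p.1.

Lemma embQ_eq (p q : Q2) : Q2eq p q <-> embQ p = embQ q.
Proof.
have key : (embQ p == embQ q) = (2 ^+ q.1 * piZ p.2 == 2 ^+ p.1 * piZ q.2).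
  rewrite eqr_div ?Q2f_pow2_neq0 // -!tofrac_pow2 -!rmorphM tofrac_eq.
  by rewrite mulrC [piZ q.2 * _]mulrC.
split=> [h | /eqP]; last by rewrite key !pow2_piZ -!piZM => /eqP /piZP.
by apply/eqP; rewrite key !pow2_piZ -!piZM; apply/eqP/piZP.
Qed.

Lemma embQD p q : embQ (Q2add p q) = embQ p + embQ q.
Proof.
rewrite /embQ /= piZD !piZM -!pow2_piZ rmorphD !rmorphM !rmorphXn !rmorph_nat.
by rewrite addf_div ?Q2f_pow2_neq0 // exprD [2 ^+ q.1 * _]mulrC [2 ^+ p.1 * _]mulrC.
Qed.
Lemma embQM p q : embQ (Q2mul p q) = embQ p * embQ q.
Proof. by rewrite /embQ /= piZM rmorphM exprD mulf_div. Qed.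
Lemma embQN p : embQ (Q2opp p) = - embQ p.
Proof. by rewrite /embQ /= piZN rmorphN mulNr. Qed.
Lemma embQB p q : embQ (Q2sub p q) = embQ p - embQ q.
Proof. by rewrite /Q2sub embQD embQN. Qed.
Lemma embQ_of z : embQ (Q2of z) = (piZ z)%:F.
Proof. by rewrite /embQ expr0 divr1. Qed.
Lemma embQ_const c : embQ (Q2const c) = c%:~R.
Proof. by rewrite embQ_of piZ_const rmorph_int. Qed.
Lemma embQ_half z : embQ (Defs.half z) = (piZ z)%:F / 2.
Proof. by rewrite /embQ expr1. Qed.

Lemma embQ_surj (x : Q2f) : exists p, embQ p = x.
Proof.
have [k [y ->]] := Q2f_dyadic x; have [y' ->] := piZ_surj y.
by exists (k, y').
Qed.

Lemma embQ_nz (p : Q2) : Q2nz p <-> embQ p != 0.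
Proof. by rewrite /Q2nz embQ_eq embQ_const; split=> [/eqP | /eqP]. Qed.

Lemma tofrac_inj : injective (@FracField.tofrac Z2r).
Proof. by move=> a b /eqP; rewrite tofrac_eq => /eqP. Qed.

Lemma Z2int_divmod (x : Q2f) (k : nat) : x \in Z2int ->
  exists (j : int) (y : Q2f), [/\ 0 <= j < 2 ^+ k, y \in Z2int & x = j%:~R + 2 ^+ k * y].
Proof.
move=> /Z2intP [a ->]; have [j [y [hj ->]]] := Z2r_divmod_pow2 a k.
exists j, y%:F; split; rewrite ?tofrac_Z2int //.
by rewrite rmorphD rmorphM rmorph_int rmorphXn rmorph_nat.
Qed.

Lemma Z2int_square_1mod8 (y : Q2f) : y \in Z2int -> exists r, 1 + 8 * y = r * r.
Proof.
move=> /Z2intP [b ->]; have [r hr] := Z2r_square_1mod8 b.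
by exists r%:F; rewrite -rmorphM -hr rmorphD rmorphM rmorph1 rmorph_nat.
Qed.

Lemma Z2int_odd_unit (y : Q2f) : y \in Z2int -> exists2 v, v \in Z2int & (1 + 2 * y) * v = 1.
Proof.
move=> /Z2intP [b ->]; have [v hv] := Z2r_odd_unit b.
exists v%:F; first exact: tofrac_Z2int.
by rewrite -[RHS](rmorph1 (@FracField.tofrac Z2r)) -hv rmorphM rmorphD rmorphM rmorph1 rmorph_nat.
Qed.

Lemma Z2int_odd_neq0 (y : Q2f) : y \in Z2int -> 1 + 2 * y != 0.
Proof.
case/Z2int_odd_unit => v _; apply: contra_eq_neq => ->.
by rewrite mul0r eq_sym oner_neq0.
Qed.

Lemma sqr_div_eq (K : fieldType) (y d z : K) : d != 0 ->
  y / d * (y / d) = z -> y * y = d * d * z.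
Proof. by move=> d0 <-; field. Qed.

Lemma Z2int_sqr (x : Q2f) : x * x \in Z2int -> x \in Z2int.
Proof.
move=> /Z2intP [z xz]; have [k [y xy]] := Q2f_dyadic x.
have yz : y * y = 2 ^+ (2 * k) * z.
  apply: tofrac_inj; rewrite !rmorphM rmorphXn rmorph_nat.
  move: xz; rewrite xy => /(sqr_div_eq (Q2f_pow2_neq0 k)) ->.
  by rewrite -exprD addnn -mul2n.
have [y0 | ny0] := eqVneq y 0; first by rewrite xy y0 rmorph0 mul0r rpred0.
have [j [w yw]] := Z2r_valuation ny0.
have [kj | jk] := leqP k j.
  apply/Z2intP; exists (2 ^+ (j - k) * (1 + 2 * w)).
  rewrite xy yw -{1}(subnK kj) exprD mulrAC rmorphM rmorphXn rmorph_nat.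
  by rewrite mulfK // Q2f_pow2_neq0.
(* otherwise the odd number (1 + 2 w)^2 would be divisible by 4^(k - j) *)
have e : (1 + 2 * w) * (1 + 2 * w) = 2 ^+ (2 * (k - j)) * z.
  apply: (mulfI (expf_neq0 (2 * j) Z2r_2_neq0)).
  rewrite [RHS]mulrA -exprD -mulnDr (subnKC (ltnW jk)) -yz yw.
  by rewrite mulrACA -exprD addnn mul2n.
have [n en] : exists n, (2 * (k - j) = n.+1)%N.
  by exists (2 * (k - j)).-1; rewrite prednK // muln_gt0 subn_gt0 jk.
exfalso; rewrite {}en in e; apply: (@Z2r_odd_neq_even (2 * w + 2 * w * w) (2 ^+ n * z)).
by rewrite mulrA -exprS -e; ring.
Qed.

(** * Quaternion algebras *)

(* Coordinates in the basis [1, i, j, ij] of the algebra [(qa, qb)]: [i^2 = qa],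
   [j^2 = qb], [ij = - ji]. *)
Record qtn (R : Type) := Qtn { c0 : R; c1 : R; c2 : R; c3 : R }.
Arguments c0 {R}. Arguments c1 {R}. Arguments c2 {R}. Arguments c3 {R}.

Section Quaternion.
Variables (R : comPzRingType) (qa qb : R).
Implicit Types (x y z h : qtn R) (c : R).

Definition qone : qtn R := Qtn 1 0 0 0.
Definition qadd x y := Qtn (c0 x + c0 y) (c1 x + c1 y) (c2 x + c2 y) (c3 x + c3 y).
Definition qsub x y := Qtn (c0 x - c0 y) (c1 x - c1 y) (c2 x - c2 y) (c3 x - c3 y).
Definition qscale c x := Qtn (c * c0 x) (c * c1 x) (c * c2 x) (c * c3 x).
Definition qconj x := Qtn (c0 x) (- c1 x) (- c2 x) (- c3 x).
Definition qmul x y :=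
  Qtn (c0 x * c0 y + qa * (c1 x * c1 y) + qb * (c2 x * c2 y) - qa * qb * (c3 x * c3 y))
      (c0 x * c1 y + c1 x * c0 y - qb * (c2 x * c3 y) + qb * (c3 x * c2 y))
      (c0 x * c2 y + c2 x * c0 y + qa * (c1 x * c3 y) - qa * (c3 x * c1 y))
      (c0 x * c3 y + c3 x * c0 y + c1 x * c2 y - c2 x * c1 y).
Definition nrd x :=
  c0 x * c0 x - qa * (c1 x * c1 x) - qb * (c2 x * c2 x) + qa * qb * (c3 x * c3 x).
Definition nrd_polar x y :=
  c0 x * c0 y - qa * (c1 x * c1 y) - qb * (c2 x * c2 y) + qa * qb * (c3 x * c3 y).
Definition qcomm x y := qmul x y = qmul y x.

Ltac qtn_ring := rewrite /qone /qadd /qsub /qscale /qconj /qmul /nrd /nrd_polar /=;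
  try congr Qtn; ring.

Lemma qmulA x y z : qmul x (qmul y z) = qmul (qmul x y) z.
Proof. by case: x y z => [? ? ? ?] [? ? ? ?] [? ? ? ?]; qtn_ring. Qed.
Lemma nrdM x y : nrd (qmul x y) = nrd x * nrd y.
Proof. by case: x y => [? ? ? ?] [? ? ? ?]; qtn_ring. Qed.
Lemma nrd_scale c x : nrd (qscale c x) = c * c * nrd x.
Proof. by case: x => [? ? ? ?]; qtn_ring. Qed.
Lemma nrd_one_sub x : nrd (qsub qone x) = 1 - 2 * c0 x + nrd x.
Proof. by case: x => [? ? ? ?]; qtn_ring. Qed.
Lemma nrd_scalar_sub c x : nrd (qsub (qscale c qone) x) = c * c - 2 * c * c0 x + nrd x.
Proof. by case: x => [? ? ? ?]; qtn_ring. Qed.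

Lemma qmulBl x y z : qmul (qsub x y) z = qsub (qmul x z) (qmul y z).
Proof. by case: x y z => [? ? ? ?] [? ? ? ?] [? ? ? ?]; qtn_ring. Qed.
Lemma qmulBr x y z : qmul z (qsub x y) = qsub (qmul z x) (qmul z y).
Proof. by case: x y z => [? ? ? ?] [? ? ? ?] [? ? ? ?]; qtn_ring. Qed.

Lemma qcomm_scalar c x : qcomm (qscale c qone) x.
Proof. by case: x => [? ? ? ?]; rewrite /qcomm; qtn_ring. Qed.
Lemma qcommB x y z : qcomm x z -> qcomm y z -> qcomm (qsub x y) z.
Proof. by rewrite /qcomm qmulBl qmulBr => -> ->. Qed.
Lemma qcommM x y z : qcomm x z -> qcomm y z -> qcomm (qmul x y) z.
Proof. by rewrite /qcomm => xz yz; rewrite -qmulA yz qmulA xz -qmulA. Qed.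

Section PureQuaternion.
Variables a1 a2 a3 : R.
Let a := Qtn 0 a1 a2 a3.
Let m := nrd a.

(* For pure [a] we have [a^2 = -m], so [r |-> -(a r a)/m] is conjugation by [a]:
   [comm_part r] and [acomm_part r] are [2 m] times the parts of [r] commuting and
   anticommuting with [a]. *)
Definition comm_part r := qsub (qscale m r) (qmul (qmul a r) a).
Definition acomm_part r := qadd (qscale m r) (qmul (qmul a r) a).

Lemma comm_partC r : qcomm (comm_part r) a.
Proof. by case: r => [? ? ? ?]; rewrite /qcomm /comm_part /m /a; qtn_ring. Qed.
Lemma comm_part_re r : c0 (comm_part r) = 2 * m * c0 r.
Proof. by case: r => [? ? ? ?]; rewrite /comm_part /m /a; qtn_ring. Qed.
Lemma nrd_comm_part r : nrd (comm_part r)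
  = m * m * ((1 + nrd r) * (1 + nrd r)) - m * nrd (qsub a (qmul (qmul r a) (qconj r))).
Proof. by case: r => [? ? ? ?]; rewrite /comm_part /m /a; qtn_ring. Qed.

Lemma acomm_part_re r : c0 (acomm_part r) = 0.
Proof. by case: r => [? ? ? ?]; rewrite /acomm_part /m /a; qtn_ring. Qed.
Lemma acomm_part_orth r : nrd_polar (acomm_part r) a = 0.
Proof. by case: r => [? ? ? ?]; rewrite /acomm_part /m /a; qtn_ring. Qed.
Lemma nrd_acomm_part r : nrd (acomm_part r)
  = m * nrd (qsub a (qmul (qmul r a) (qconj r))) - m * m * ((nrd r - 1) * (nrd r - 1)).
Proof. by case: r => [? ? ? ?]; rewrite /acomm_part /m /a; qtn_ring. Qed.

Lemma qcomm_pure_span c q : qcomm (qadd (qscale c qone) (qscale q a)) a.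
Proof. by rewrite /qcomm /a; qtn_ring. Qed.
Lemma nrd_pure_span c q : nrd (qadd (qscale c qone) (qscale q a)) = c * c + q * q * m.
Proof. by rewrite /m /a; qtn_ring. Qed.

Definition qcomb k0 k1 k2 E := qadd (qscale k0 qone) (qadd (qscale k1 a) (qscale k2 E)).

Lemma qcomb_re k0 k1 k2 E : c0 E = 0 -> c0 (qcomb k0 k1 k2 E) = k0.
Proof. by case: E => [? ? ? ?] /= ->; rewrite /qcomb /a; qtn_ring. Qed.
Lemma nrd_qcomb k0 k1 k2 E : c0 E = 0 -> nrd (qcomb k0 k1 k2 E)
  = k0 * k0 + k1 * k1 * m + k2 * k2 * nrd E + 2 * k1 * k2 * nrd_polar E a.
Proof. by case: E => [? ? ? ?] /= ->; rewrite /qcomb /m /a; qtn_ring. Qed.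
Lemma polar_qcomb k0 k1 k2 E :
  nrd_polar (qcomb k0 k1 k2 E) a = k1 * m + k2 * nrd_polar E a.
Proof. by case: E => [? ? ? ?]; rewrite /qcomb /m /a; qtn_ring. Qed.

Lemma nrd_commutator h :
  4 * (m * (nrd h - c0 h * c0 h)) = 4 * nrd_polar h a ^+ 2 + nrd (qsub (qmul h a) (qmul a h)).
Proof. by case: h => [? ? ? ?]; rewrite /m /a; qtn_ring. Qed.

Lemma nrd_centralizer h : qcomm h a ->
  4 * (m * (nrd h - c0 h * c0 h)) = 4 * nrd_polar h a ^+ 2.
Proof.
move=> hC; rewrite nrd_commutator hC.
by case: (qmul a h) => [? ? ? ?]; qtn_ring.
Qed.

End PureQuaternion.
End Quaternion.
Arguments qone {R}.

(** * Anisotropy of the norm form of D *)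

Lemma nrd25_mod16_even (n0 n1 n2 n3 : nat) :
  (n0 < 8)%N -> (n1 < 8)%N -> (n2 < 8)%N -> (n3 < 8)%N ->
  ((n0 * n0 + 10 * (n3 * n3)) %% 16 = (2 * (n1 * n1) + 5 * (n2 * n2)) %% 16)%N ->
  [&& ~~ odd n0, ~~ odd n1, ~~ odd n2 & ~~ odd n3].
Proof.
have table : all (fun n0 => all (fun n1 => all (fun n2 => all (fun n3 =>
    ((n0 * n0 + 10 * (n3 * n3)) %% 16 == (2 * (n1 * n1) + 5 * (n2 * n2)) %% 16)%N
    ==> [&& ~~ odd n0, ~~ odd n1, ~~ odd n2 & ~~ odd n3])
  (iota 0 8)) (iota 0 8)) (iota 0 8)) (iota 0 8) by vm_compute.
move=> h0 h1 h2 h3 /eqP he.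
move: table => /allP /(_ n0); rewrite mem_iota h0 => /(_ isT).
move=> /allP /(_ n1); rewrite mem_iota h1 => /(_ isT).
move=> /allP /(_ n2); rewrite mem_iota h2 => /(_ isT).
by move=> /allP /(_ n3); rewrite mem_iota h3 he => /(_ isT).
Qed.

Lemma Z2r_even_of_digit (z w : Z2r) (n : nat) :
  ~~ odd n -> z = n%:R + 2 ^+ 3 * w -> exists v, z = 2 * v.
Proof.
move=> en ->; exists ((n./2)%:R + 4 * w).
rewrite -{1}(even_halfK en) -addnn natrD; move: (n./2)%:R => p.
by rewrite !exprS expr0; ring.
Qed.

Lemma Z2r_nrd25_eq0_even (z : qtn Z2r) :
  nrd 2 5 z = 0 -> exists v, z = qscale 2 v.
Proof.
case: z => z0 z1 z2 z3; rewrite /nrd /=.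
have [j0 [w0 [h0 e0]]] := Z2r_divmod_pow2 z0 3.
case: j0 h0 e0 => [n0|//] /andP [_ h0] e0.
have [j1 [w1 [h1 e1]]] := Z2r_divmod_pow2 z1 3.
case: j1 h1 e1 => [n1|//] /andP [_ h1] e1.
have [j2 [w2 [h2 e2]]] := Z2r_divmod_pow2 z2 3.
case: j2 h2 e2 => [n2|//] /andP [_ h2] e2.
have [j3 [w3 [h3 e3]]] := Z2r_divmod_pow2 z3 3.
case: j3 h3 e3 => [n3|//] /andP [_ h3] e3.
move=> hQ.
(* reducing the norm form modulo 16 leaves only the digits *)
pose J : int := (n0 * n0 + 10 * (n3 * n3))%N%:Z - (2 * (n1 * n1) + 5 * (n2 * n2))%N%:Z.
pose T := (n0%:R * w0 + 4 * (w0 * w0)) - 2 * (n1%:R * w1 + 4 * (w1 * w1))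
   - 5 * (n2%:R * w2 + 4 * (w2 * w2)) + 10 * (n3%:R * w3 + 4 * (w3 * w3)) : Z2r.
have hJ : (J%:~R : Z2r) = 2 ^+ 4 * (- T).
  apply/eqP; rewrite -subr_eq0 -[X in _ == X]hQ; apply/eqP.
  have nat_intr (n : nat) : ((n : int)%:~R : Z2r) = n%:R by [].
  rewrite /J e0 e1 e2 e3 /T intrB !nat_intr !natrD !natrM.
  move: (n0%:R : Z2r) (n1%:R : Z2r) (n2%:R : Z2r) (n3%:R : Z2r) => a b c d.
  by rewrite !exprS expr0; ring.
have hm : ((n0 * n0 + 10 * (n3 * n3)) %% 16 = (2 * (n1 * n1) + 5 * (n2 * n2)) %% 16)%N.
  by move: (Z2r_int_pow2_dvd hJ); rewrite /J (_ : (2 ^+ 4 : int) = 16) //; lia.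
have := nrd25_mod16_even _ _ _ _ hm; rewrite -!(ltz_nat _ 8).
move=> /(_ h0 h1 h2 h3) /and4P [o0 o1 o2 o3].
have [v0 ->] := Z2r_even_of_digit o0 e0; have [v1 ->] := Z2r_even_of_digit o1 e1.
have [v2 ->] := Z2r_even_of_digit o2 e2; have [v3 ->] := Z2r_even_of_digit o3 e3.
by exists (Qtn v0 v1 v2 v3).
Qed.

Lemma Z2r_nrd25_anisotropic (z : qtn Z2r) : nrd 2 5 z = 0 -> z = Qtn 0 0 0 0.
Proof.
move=> hz; have descent k : exists v, nrd 2 5 v = 0 /\ z = qscale (2 ^+ k) v.
  elim: k => [|k [v [hv ->]]].
    by exists z; split=> //; case: (z) => *; rewrite /qscale /= !mul1r.
  have [u vu] := Z2r_nrd25_eq0_even hv; rewrite {v}vu in hv *; exists u; split.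
    by move: hv; rewrite nrd_scale -expr2 => /Z2r_pow2_mul_eq0.
  by case: u {hv} => *; rewrite /qscale /= exprSr; congr Qtn; ring.
have coord (f : qtn Z2r -> Z2r) : (forall c v, f (qscale c v) = c * f v) -> f z = 0.
  move=> fZ; apply: Z2r_pow2_dvd_eq0 => k.
  by have [v [_ ->]] := descent k; exists (f v).
have := coord c0 (fun _ _ => erefl); have := coord c1 (fun _ _ => erefl).
have := coord c2 (fun _ _ => erefl); have := coord c3 (fun _ _ => erefl).
by case: z {hz descent coord} => z0 z1 z2 z3 /= -> -> -> ->.
Qed.

Lemma Q2f_pow2_scale_int (x : Q2f) : exists k, forall l, (k <= l)%N -> 2 ^+ l * x \in Z2int.
Proof.
have [k [y ->]] := Q2f_dyadic x; exists k => l kl.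
rewrite -(subnK kl) exprD -mulrA [2 ^+ k * _]mulrC divfK ?Q2f_pow2_neq0 //.
by rewrite rpredM ?rpredX ?rpred_nat ?tofrac_Z2int.
Qed.

Lemma Q2f_nrd25_anisotropic (x : qtn Q2f) : nrd 2 5 x = 0 -> x = Qtn 0 0 0 0.
Proof.
case: x => x0 x1 x2 x3 hx.
have [k0 s0] := Q2f_pow2_scale_int x0; have [k1 s1] := Q2f_pow2_scale_int x1.
have [k2 s2] := Q2f_pow2_scale_int x2; have [k3 s3] := Q2f_pow2_scale_int x3.
pose K := (k0 + k1 + k2 + k3)%N.
have /Z2intP [z0 e0] : 2 ^+ K * x0 \in Z2int by apply: s0; rewrite /K; lia.
have /Z2intP [z1 e1] : 2 ^+ K * x1 \in Z2int by apply: s1; rewrite /K; lia.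
have /Z2intP [z2 e2] : 2 ^+ K * x2 \in Z2int by apply: s2; rewrite /K; lia.
have /Z2intP [z3 e3] : 2 ^+ K * x3 \in Z2int by apply: s3; rewrite /K; lia.
have : (nrd 2 5 (Qtn z0 z1 z2 z3))%:F = nrd 2 5 (qscale (2 ^+ K) (Qtn x0 x1 x2 x3)).
  by rewrite /nrd /= e0 e1 e2 e3 !(rmorphD, rmorphN, rmorphM, rmorph_nat).
rewrite nrd_scale hx mulr0 -(rmorph0 (@FracField.tofrac Z2r)) => /tofrac_inj.
case/Z2r_nrd25_anisotropic => ez0 ez1 ez2 ez3.
have hK : (2 : Q2f) ^+ K != 0 := Q2f_pow2_neq0 K.
by congr Qtn; apply/eqP; rewrite -(mulrI_eq0 _ (mulfI hK))
  ?e0 ?e1 ?e2 ?e3 ?ez0 ?ez1 ?ez2 ?ez3 rmorph0.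
Qed.

(** * The k-star conditions are unsatisfiable *)

Lemma Z2int_mod8_cases (x : Q2f) : x \in Z2int ->
  (exists2 n, n \in Z2int & x = 1 + 8 * n) \/
  exists (e : nat) (o y : Q2f), [/\ (e <= 2)%N, y \in Z2int, o = 1 + 2 * y & x - 1 = 2 ^+ e * o].
Proof.
move=> xZ; have [j [n [/andP [j0 j8] nZ ex]]] := Z2int_divmod 3 xZ.
set goal := (_ \/ _).
have odd_case (e : nat) (c : int) (d : nat) : (e <= 2)%N ->
    x - 1 = 2 ^+ e * (1 + 2 * (c%:~R + d%:R * n)) -> goal.
  move=> he hx; right; exists e, (1 + 2 * (c%:~R + d%:R * n)), (c%:~R + d%:R * n).
  by split; rewrite ?rpredD ?rpredM ?rpred_int ?rpred_nat.
have : [|| j == 0, j == 1, j == 2, j == 3, j == 4, j == 5, j == 6 | j == 7] by lia.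
move=> /or4P [/eqP j_ | /eqP j_ | /eqP j_ |
  /or4P [/eqP j_ | /eqP j_ | /eqP j_ | /orP [/eqP j_ | /eqP j_]]]; rewrite {}j_ {j0 j8} in ex.
- by apply: (odd_case 0%N (-1) 4) => //; rewrite ex; ring.
- by left; exists n => //; rewrite ex; ring.
- by apply: (odd_case 0%N 0 4) => //; rewrite ex; ring.
- by apply: (odd_case 1%N 0 2) => //; rewrite ex; ring.
- by apply: (odd_case 0%N 1 4) => //; rewrite ex; ring.
- by apply: (odd_case 2%N 0 1) => //; rewrite ex; ring.
- by apply: (odd_case 0%N 2 4) => //; rewrite ex; ring.
- by apply: (odd_case 1%N 1 2) => //; rewrite ex; ring.
Qed.

Lemma Z2int_1mod8_square (y : Q2f) : y \in Z2int -> exists2 r, r != 0 & 1 + 8 * y = r * r.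
Proof.
move=> yZ; have [r er] := Z2int_square_1mod8 yZ; exists r; last exact: er.
apply: contra_neq (Z2int_odd_neq0 (rpredM (rpred_nat _ 4) yZ)) => r0.
by rewrite mulrA -natrM er r0 mulr0.
Qed.

Lemma Z2int_1mod4_square_class (k : Q2f) : k \in Z2int ->
  exists (five : bool) (rho : Q2f), rho != 0 /\ 1 + 4 * k = (if five then 5 else 1) * (rho * rho).
Proof.
move=> kZ; have [j [k' [/andP [j0 j2] k'Z ek]]] := Z2int_divmod 1 kZ.
have : (j == 0) || (j == 1) by lia.
case/orP => /eqP j_; rewrite {}j_ in ek.
  have [rho rho0 erho] := Z2int_1mod8_square k'Z.
  by exists false, rho; rewrite -erho ek; split; [exact: rho0 | ring].
have [v vZ v5] := @Z2int_odd_unit 2 (rpred_nat _ 2).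
have [rho rho0 erho] := Z2int_1mod8_square (rpredM k'Z vZ).
exists true, rho; rewrite -erho; split; first exact: rho0.
(* 5 is a unit, so dividing by it moves 1 + 4 k = 5 + 8 k' into 1 + 8 Z_2 *)
have -> : 5 * (1 + 8 * (k' * v)) = 5 + 8 * k' * ((1 + 2 * 2) * v) by ring.
by rewrite v5 ek; ring.
Qed.

Lemma Z2int_1mod4_sum_sq (five : bool) (c : Q2f) : c \in Z2int ->
  exists p q : Q2f, 1 + 4 * c = p * p + (if five then 5 else 1) * (q * q).
Proof.
case/Z2int_1mod4_square_class => [[] [rho [_ ->]]]; first case: five.
- by exists 0, rho; ring.
- by exists (2 * rho), rho; ring.
- by exists rho, 0; ring.
Qed.

Lemma nrd_order_elt (K : fieldType) (A B G D : K) : (2 : K) != 0 ->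
  nrd 2 5 (Qtn ((2 * A + B) / 2) ((2 * G + D) / 2) (B / 2) (D / 2))
  = A * A + A * B - B * B - 2 * (G * G) - 2 * (G * D) + 2 * (D * D).
Proof. by move=> two0; rewrite /nrd /=; field. Qed.

Lemma Z2int_sqrt_pow2 (W w : Q2f) (t : nat) : (3 <= t)%N -> w \in Z2int ->
  W * W = w * (2 ^+ t * 2 ^+ t) -> exists2 W0, W0 \in Z2int & W = 8 * W0.
Proof.
move=> t3 wZ eW; have two_t := Q2f_pow2_neq0 t.
have W1Z : W / 2 ^+ t \in Z2int.
  by apply: Z2int_sqr; rewrite mulf_div eW mulfK ?mulf_neq0.
exists (2 ^+ (t - 3) * (W / 2 ^+ t)); first by rewrite rpredM ?rpredX ?rpred_nat.
have -> : (8 : Q2f) = 2 ^+ 3 by ring.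
by rewrite mulrA -exprD subnKC // mulrC divfK.
Qed.

Local Notation nrd25 := (@nrd Q2f 2 5).
Local Notation polar25 := (@nrd_polar Q2f 2 5).
Local Notation qmul25 := (@qmul Q2f 2 5).

Section PureNormClass.
Variables (a1 a2 a3 mu : Q2f) (five : bool).
Local Notation a := (Qtn 0 a1 a2 a3).
Local Notation m := (nrd25 a).
Hypotheses (mu0 : mu != 0) (norm_a : m = (if five then 5 else 1) * (mu * mu)).

Lemma norm_pure_neq0 : m != 0.
Proof.
have five0 : (5 : Q2f) != 0.
  have -> : (5 : Q2f) = 1 + 2 * 2 by ring.
  exact/Z2int_odd_neq0/rpred_nat.
rewrite norm_a; apply: mulf_neq0; last exact: mulf_neq0.
by case: (five); [exact: five0 | exact: oner_neq0].
Qed.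

Lemma qcomb_isotropic k0 k1 k2 E : c0 E = 0 ->
  nrd25 (qcomb a1 a2 a3 k0 k1 k2 E) = 0 -> k0 = 0 /\ k1 * m + k2 * polar25 E a = 0.
Proof.
move=> E0 /Q2f_nrd25_anisotropic h0; split.
  by rewrite -(qcomb_re a1 a2 a3 k0 k1 k2 E0) h0.
by rewrite -(polar_qcomb 2 5 a1 a2 a3 k0) h0 /nrd_polar /=; ring.
Qed.

(* Each square class of [1 + 4 k] yields an isotropic vector in the span of [1, a, E]. *)
Lemma orth_pure_norm_square_class (E : qtn Q2f) (l k : Q2f) :
  c0 E = 0 -> polar25 E a = 0 -> l != 0 -> k \in Z2int ->
  nrd25 E = - (l * l * (1 + 4 * k)) -> False.
Proof.
move=> E0 Ea l0 /Z2int_1mod4_square_class [five' [rho [rho0 ek]]].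
set L := l * rho; have L0 : L != 0 by apply: mulf_neq0.
have {ek} -> : l * l * (1 + 4 * k) = (if five' then 5 else 1) * (L * L) by rewrite ek /L; ring.
case: five' => NE; last first.
  suff /(@qcomb_isotropic L 0 1 E E0) [L_0 _] : nrd25 (qcomb a1 a2 a3 L 0 1 E) = 0.
    by move/eqP: L0; rewrite L_0.
  by rewrite nrd_qcomb // NE Ea; ring.
have m0 := norm_pure_neq0; move: norm_a; case: (five) => ma.
  suff /(@qcomb_isotropic 0 L mu E E0) [_] : nrd25 (qcomb a1 a2 a3 0 L mu E) = 0.
    by rewrite Ea mulr0 addr0 => /eqP; rewrite mulf_eq0 (negPf L0) (negPf m0).
  by rewrite nrd_qcomb // NE Ea ma; ring.
suff /(@qcomb_isotropic (L * mu) (2 * L) mu E E0) [/eqP] :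
    nrd25 (qcomb a1 a2 a3 (L * mu) (2 * L) mu E) = 0.
  by rewrite mulf_eq0 (negPf L0) (negPf mu0).
by rewrite nrd_qcomb // NE Ea ma; ring.
Qed.

Lemma orth_pure_norm_not_diff_sq (E : qtn Q2f) (W0 o y : Q2f) (e : nat) :
  c0 E = 0 -> polar25 E a = 0 -> W0 \in Z2int -> y \in Z2int -> o = 1 + 2 * y ->
  (e <= 2)%N -> nrd25 E = m * m * ((8 * W0) ^+ 2 - (2 ^+ e * o) ^+ 2) -> False.
Proof.
move=> E0 Ea W0Z yZ oy e2 NE; have [v vZ ov] := Z2int_odd_unit yZ; rewrite -oy in ov.
pose c : Q2f := 2 ^+ (2 - e).
have pc : 2 ^+ e * c = 4 by rewrite /c -exprD subnKC //; ring.
apply: (@orth_pure_norm_square_class E (m * 2 ^+ e * o) (- (c * W0 * v) ^+ 2) E0 Ea).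
- rewrite oy; apply: mulf_neq0; last exact: Z2int_odd_neq0.
  by apply: mulf_neq0; [exact: norm_pure_neq0 | exact: Q2f_pow2_neq0].
- by rewrite rpredN rpredX ?rpredM ?rpredX ?rpred_nat.
apply/eqP; rewrite NE -subr_eq0; apply/eqP.
transitivity (4 * (m * m) * (W0 * W0) * (16 - (2 ^+ e * c) ^+ 2 * (o * v) ^+ 2)); first by ring.
by rewrite pc ov; ring.
Qed.

Lemma norm_1mod8_hilbert (r : qtn Q2f) (n W0 : Q2f) :
  n \in Z2int -> W0 \in Z2int -> nrd25 r = 1 + 8 * n ->
  m * nrd25 (qsub a (qmul25 (qmul25 r a) (qconj r))) = m * m * (8 * W0) ^+ 2 ->
  exists X Y Z : Q2f, X != 0 /\ Z * Z = nrd25 (qsub qone r) * (X * X) + (- m) * (Y * Y).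
Proof.
move=> nZ W0Z Nr Nz; have m0 := norm_pure_neq0.
pose al := 1 + 4 * (n + W0).
have al0 : al != 0.
  have -> : al = 1 + 2 * (2 * (n + W0)) by rewrite /al; ring.
  by apply: Z2int_odd_neq0; rewrite rpredM ?rpred_nat ?rpredD.
have [p [q alpq]] := Z2int_1mod4_sum_sq five (rpredD nZ W0Z).
(* [h = K b] commutes with [a], hence lies in [Q_2(a)] and its norm is a norm from [Q_2(a)] *)
pose K := qsub (qscale (2 * m * al) qone) (comm_part 2 5 a1 a2 a3 r).
pose b := qadd (qscale (mu * p) qone) (qscale (- q) a).
pose h := qmul25 K b.
have hC : qcomm 2 5 h a.
  apply: qcommM; last exact: qcomm_pure_span.
  by apply: qcommB; [exact: qcomm_scalar | exact: comm_partC].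
have NK : nrd25 K = 4 * (m * m) * al * nrd25 (qsub qone r).
  rewrite /K nrd_scalar_sub comm_part_re nrd_comm_part Nz nrd_one_sub Nr /al.
  by move: (nrd25 a) (c0 r) => M r0; ring.
have Nb : nrd25 b = mu * mu * al.
  by rewrite /b nrd_pure_span norm_a /al alpq; case: (five); ring.
pose X := 2 * m * mu * al.
have Nh : nrd25 h = nrd25 (qsub qone r) * (X * X).
  by rewrite /h nrdM NK Nb /X; move: (nrd25 a) (nrd25 (qsub qone r)) => M N1; ring.
have four0 : (4 : Q2f) != 0 by move: (Q2f_pow2_neq0 2); rewrite expr2 -natrM.
have key := mulfI four0 (nrd_centralizer hC).
exists X, (polar25 h a / m), (c0 h); split.
  exact: mulf_neq0 (mulf_neq0 (mulf_neq0 Q2f_2_neq0 m0) mu0) al0.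
apply: (mulfI m0); rewrite -Nh; move: key; clearbody h => key.
transitivity (m * nrd25 h - (polar25 h a / m * m) ^+ 2); last by ring.
rewrite divfK ?m0 // -key.
by move: (nrd25 a) (nrd25 h) (c0 h) => M Nh0 h0; ring.
Qed.

Lemma kstar_norm_hilbert (A B G D : Z2r) (w s : Q2f) (t : nat) :
  (3 <= t)%N -> w \in Z2int ->
  let r := Qtn ((2 * A%:F + B%:F) / 2) ((2 * G%:F + D%:F) / 2) (B%:F / 2) (D%:F / 2) in
  let z := qsub a (qmul25 (qmul25 r a) (qconj r)) in
  nrd25 z * m = s * s -> nrd25 z = w * (2 ^+ t * 2 ^+ t * m) ->
  exists X Y Z : Q2f, X != 0 /\ Z * Z = nrd25 (qsub qone r) * (X * X) + (- m) * (Y * Y).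
Proof.
move=> t3 wZ r z zs zw; have m0 := norm_pure_neq0.
have NrZ : nrd25 r \in Z2int.
  rewrite /r nrd_order_elt; last exact: Q2f_2_neq0.
  apply/Z2intP; exists (A * A + A * B - B * B - 2 * (G * G) - 2 * (G * D) + 2 * (D * D)).
  by rewrite !(rmorphD, rmorphN, rmorphM, rmorph_nat).
pose W := s / m.
have eW : m * nrd25 z = m * m * (W * W).
  by rewrite mulrC zs -[s](divfK m0) -/W; move: (nrd25 a) => M; ring.
have [W0 W0Z eW0] : exists2 W0, W0 \in Z2int & W = 8 * W0.
  apply: (Z2int_sqrt_pow2 t3 wZ); apply: (mulfI (mulf_neq0 m0 m0)).
  by rewrite -eW zw; move: (nrd25 a) => M; ring.
case: (Z2int_mod8_cases NrZ) => [[n nZ Nr] | [e [o [y [e2 yZ oy Nr1]]]]].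
  by apply: (norm_1mod8_hilbert nZ W0Z Nr); rewrite eW eW0.
exfalso; apply: (@orth_pure_norm_not_diff_sq (acomm_part 2 5 a1 a2 a3 r) W0 o y e
  (acomm_part_re _ _ _ _ _ r) (acomm_part_orth _ _ _ _ _ r) W0Z yZ oy e2).
rewrite nrd_acomm_part -/z eW -Nr1 -eW0.
by move: (nrd25 a) (nrd25 r) => M Nr0; ring.
Qed.
End PureNormClass.

(** * Comparison with the coordinate model *)

Definition embD (x : quat) : qtn Q2f :=
  Qtn (embQ (q0 x)) (embQ (q1 x)) (embQ (q2 x)) (embQ (q3 x)).

Lemma embD_mul x y : embD (quat_mul x y) = qmul 2 5 (embD x) (embD y).
Proof.
rewrite /embD /quat_mul /Qa /Qb /q0 /q1 /q2 /q3 /mkq /=.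
by rewrite !(embQD, embQB, embQM, embQ_const) /qmul /=; congr Qtn; ring.
Qed.
Lemma embD_sub x y : embD (quat_sub x y) = qsub (embD x) (embD y).
Proof. by rewrite /embD /= !embQB. Qed.
Lemma embD_conj x : embD (quat_conj x) = qconj (embD x).
Proof. by rewrite /embD /= !embQN. Qed.
Lemma embD_one : embD quat_one = qone.
Proof. by rewrite /embD /= !embQ_const. Qed.
Lemma embD_scale c x : embD (quat_scale c x) = qscale (embQ c) (embD x).
Proof. by rewrite /embD /= !embQM. Qed.
Lemma embQ_qnorm x : embQ (qnorm x) = nrd 2 5 (embD x).
Proof. by rewrite /qnorm /Qa /Qb !(embQD, embQB, embQM, embQ_const). Qed.
Lemma embD_OD al be ga de : embD (OD_elt al be ga de) =
  Qtn ((2 * (piZ al)%:F + (piZ be)%:F) / 2) ((2 * (piZ ga)%:F + (piZ de)%:F) / 2)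
      ((piZ be)%:F / 2) ((piZ de)%:F / 2).
Proof.
rewrite /embD /= !embQ_half !piZD !piZM !rmorphD !rmorphM piZ_const.
by rewrite !rmorph_int.
Qed.

Lemma hilbert_m1_embQ (x y : Q2) : hilbert_m1 x y ->
  ~ exists X Y Z : Q2f, X != 0 /\ Z * Z = embQ x * (X * X) + embQ y * (Y * Y).
Proof.
move=> hxy [X [Y [Z [X0 e]]]]; apply: hxy.
have [X' eX] := embQ_surj X; have [Y' eY] := embQ_surj Y; have [Z' eZ] := embQ_surj Z.
exists X', Y', Z'; split; first by left; apply/embQ_nz; rewrite eX.
by apply/embQ_eq; rewrite embQD !embQM eX eY eZ.
Qed.

Lemma nonminimal_norm_class (a1 : quat) (u : Z2) : nonminimal_defect_unit u ->
  (exists q, Q2nzsq q /\ Q2eq (qnorm a1) (Q2mul (Q2opp (Q2of u)) q)) ->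
  exists (five : bool) (mu : Q2f),
    mu != 0 /\ embQ (qnorm a1) = (if five then 5 else 1) * (mu * mu).
Proof.
move=> [s [[v /piZP sv] us]] [q [[/embQ_nz q0 [S /embQ_eq qS]] /embQ_eq Nq]].
rewrite piZM piZ1 in sv.
have s0 : (piZ s)%:F != 0.
  by apply: contra_eq_neq sv => /eqP; rewrite tofrac_eq0 => /eqP ->; rewrite mul0r eq_sym oner_neq0.
rewrite embQM in qS; have S0 : embQ S != 0 by apply: contra_neq q0; rewrite qS => ->; rewrite mulr0.
rewrite embQM embQN embQ_of qS in Nq.
have [five eu] : exists five : bool, piZ u = - ((if five then 5 else 1) * (piZ s * piZ s)).
  by case: us => /piZP; rewrite piZN !piZM ?piZ_const => ->; [exists false | exists true]; ring.
exists five, ((piZ s)%:F * embQ S); split; first exact: mulf_neq0.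
rewrite Nq eu; case: (five); rewrite !rmorphN !rmorphM ?rmorph_nat ?rmorph1; ring.
Qed.

Lemma kstar_unsat (a1 : quat) (u : Z2) (t : nat) (al be ga de : Z2) :
  pure a1 -> nonminimal_defect_unit u ->
  (exists q, Q2nzsq q /\ Q2eq (qnorm a1) (Q2mul (Q2opp (Q2of u)) q)) ->
  (3 <= t)%N -> ~ kstar a1 t (OD_elt al be ga de).
Proof.
move=> /embQ_eq pa hu hq t3 [hil [_ [s /embQ_eq zs]] [_ [w /embQ_eq zw]]].
have [five [mu [mu0 Na]]] := nonminimal_norm_class hu hq.
have ea : embD a1 = Qtn 0 (embQ (q1 a1)) (embQ (q2 a1)) (embQ (q3 a1)).
  by rewrite /embD pa embQ_const.
rewrite embQ_qnorm ea in Na.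
apply: (hilbert_m1_embQ hil).
rewrite embQN !embQ_qnorm embD_sub embD_one embD_OD ea.
apply: (kstar_norm_hilbert mu0 Na t3 (tofrac_Z2int (piZ w))).
  by rewrite !embQM !embQ_qnorm embD_sub !embD_mul embD_conj embD_OD ea in zs; exact: zs.
move: zw; rewrite !embQM embQ_of !embQ_qnorm embD_scale nrd_scale embQ_const.
rewrite embD_sub !embD_mul embD_conj embD_OD ea => ->.
by rewrite rmorphXn rmorph_nat mulrA.
Qed.

Theorem proposition5p2 (a1 : quat) (u : Z2) (t : nat) :
  pure a1 ->
  nonminimal_defect_unit u ->
  (exists q : Q2, Q2nzsq q /\ Q2eq (qnorm a1) (Q2mul (Q2opp (Q2of u)) q)) ->
  (t = 3%N \/ t = 4%N) ->
  ((exists al be ga de : Z2, kstar a1 t (OD_elt al be ga de)) <->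
   (exists a b c d : int,
      [/\ 0 <= a < 2 ^+ (t + 3), 0 <= b < 2 ^+ (t + 3),
          0 <= c < 2 ^+ (t + 3) & 0 <= d < 2 ^+ (t + 3)] /\
      kstar a1 t (OD_elt (Z2const a) (Z2const b) (Z2const c) (Z2const d)))).
Proof.
move=> pa hu hq ht; split; last first.
  by case=> a [b [c [d [_ hk]]]]; exists (Z2const a), (Z2const b), (Z2const c), (Z2const d).
case=> al [be [ga [de hk]]]; exfalso.
by apply: (kstar_unsat pa hu hq _ hk); case: ht => ->.
Qed.
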